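(* Let $\mathbb{F}$ be a field. There is an equivalence of categories between the category $EXT$ of extensions of commutative Poisson algebras over $\mathbb{F}$ and the category $FAC$ of factor systems over $\mathbb{F}$.
   Context: All vector spaces are over a field $\mathbb{F}$; ''vector space homomorphism'' means $\mathbb{F}$-linear map. A commutative Poisson algebra is a vector space $P$ with bilinear operations $\cdot$ and $[\ ,\ ]$ such that $(P,\cdot)$ is a commutative associative $\mathbb{F}$-algebra (no unit required), $(P,[\ ,\ ])$ is a Lie algebra (with $[x,x]=0$ and the Jacobi identity), and $[x\cdot y,z]=[x,z]\cdot y+x\cdot[y,z]$ for all $x,y,z$. A Poisson algebra homomorphism is a linear map preserving both operations. A Poisson derivation of $P$ is a linear map $D:P\to P$ with $D(xy)=D(x)y+xD(y)$ and $D([x,y])=[D(x),y]+[x,D(y)]$; $Der(P)$ is the vector space of all of them; $End(P)$ is the vector space of all linear maps $P\to P$. Category $EXT$: objects are extensions, i.e. short exact sequences $\mathcal{E}(H,K)\equiv 0\to H\xrightarrow{i}P\xrightarrow{\beta}K\to 0$ of commutative Poisson algebras and Poisson algebra homomorphisms. A morphism from $0\to H_1\xrightarrow{i_1}P_1\xrightarrow{\beta_1}K_1\to0$ to $0\to H_2\xrightarrow{i_2}P_2\xrightarrow{\beta_2}K_2\to0$ is a triple $(\lambda,\mu,\nu)$ of Poisson algebra homomorphisms $\lambda:H_1\to H_2$, $\mu:P_1\to P_2$, $\nu:K_1\to K_2$ with $\mu i_1=i_2\lambda$ and $\nu\beta_1=\beta_2\mu$; composition is componentwise. Category $FAC$: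 objects are factor systems, i.e. sextuples $(H,K,f,h,\gamma,\Gamma)$, where $H,K$ are commutative Poisson algebras, $f:K\times K\to H$ is a symmetric bilinear map, $h:K\times K\to H$ is an alternating bilinear map ($h(x,x)=0$), and $\gamma:K\to End(H)$, $x\mapsto\gamma_x$, and $\Gamma:K\to Der(H)$, $x\mapsto\Gamma_x$, are vector space homomorphisms such that for all $x,y,z\in K$, $a,b\in H$: - $\gamma_{xy}(a)=\gamma_y(\gamma_x(a))-a f(x,y)=\gamma_x(\gamma_y(a))-a f(x,y)$; - $\gamma_{[x,y]}(a)=\Gamma_y(\gamma_x(-a))+\gamma_x(\Gamma_y(a))-a\,h(x,y)$; - $\gamma_x(ab)=a\gamma_x(b)=b\gamma_x(a)$; - $\gamma_x([a,b])=[\gamma_x(a),b]-a\,\Gamma_x(b)$; - $\Gamma_{xy}(a)=\gamma_y(\Gamma_x(a))+\gamma_x(\Gamma_y(a))+[a,f(x,y)]$; - $\Gamma_{[x,y]}(a)=\Gamma_x\Gamma_y(a)-\Gamma_y\Gamma_x(a)-[h(x,y),a]$; - $\gamma_z(f(x,y))+f(xy,z)=\gamma_x(f(y,z))+f(x,yz)$; - $h([x,y],z)+h([y,z],x)+h([z,x],y)=\Gamma_z(h(x,y))+\Gamma_x(h(y,z))+\Gamma_y(h(z,x))$; - $h(xy,z)=\Gamma_z(f(x,y))+\gamma_y(h(x,z))+f([x,z],y)+\gamma_x(h(y,z))+f(x,[y,z])$. A morphism in $FAC$ from $(H_1,K_1,f^1,h^1,\gamma^1,\Gamma^1)$ to $(H_2,K_2,f^2,h^2,\gamma^2,\Gamma^2)$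 is a triple $(\lambda,g,\nu)$, where $\lambda:H_1\to H_2$ and $\nu:K_1\to K_2$ are Poisson algebra homomorphisms and $g:K_1\to H_2$ is a vector space homomorphism, such that for all $x,y,z\in K_1$, $a\in H_1$: - $h^2(\nu(x),\nu(y))+\Gamma^2_{\nu(x)}(g(y))-\Gamma^2_{\nu(y)}(g(x))+[g(x),g(y)]=g([x,y])+\lambda(h^1(x,y))$; - $\lambda(\Gamma^1_x(a))=\Gamma^2_{\nu(x)}(\lambda(a))+[g(x),\lambda(a)]$; - $\lambda(f^1(x,y))+g(xy)=g(x)\cdot g(y)+\gamma^2_{\nu(y)}(g(x))+\gamma^2_{\nu(x)}(g(y))+f^2(\nu(x),\nu(y))$; - $\lambda(\gamma^1_x(a))=\lambda(a)\cdot g(x)+\gamma^2_{\nu(x)}(\lambda(a))$; - writing $A(u,z)=h^2(\nu(u),\nu(z))+\Gamma^2_{\nu(u)}(g(z))-\Gamma^2_{\nu(z)}(g(u))+[g(u),g(z)]$, $$g([xy,z])-\lambda(\Gamma^1_z(f^1(x,y)))+\lambda(h^1(xy,z))=A(x,z)\cdot g(y)+\gamma^2_{\nu(y)}(A(x,z))+\gamma^2_{\nu([x,z])}(g(y))+f^2(\nu([x,z]),\nu(y))+g(x)\cdot A(y,z)+\gamma^2_{\nu([y,z])}(g(x))+\gamma^2_{\nu(x)}(A(y,z))+f^2(\nu(x),\nu([y,z])).$$ The composite of $(\lambda_1,g_1,\nu_1)$ followed by $(\lambda_2,g_2,\nu_2)$ is $(\lambda_2\circ\lambda_1,\ g_3,\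 \nu_2\circ\nu_1)$ with $g_3(x)=g_2(\nu_1(x))+\lambda_2(g_1(x))$. *)

(* Defs.v *)
From HB Require Import structures.
From mathcomp Require Import all_boot all_algebra.
From mathcomp Require Import boolp.

Set Implicit Arguments.
Unset Strict Implicit.
Unset Printing Implicit Defensive.

Import GRing.Theory.
Local Open Scope ring_scope.

Record category := Category {
  obj :> Type;
  hom : obj -> obj -> Type;
  idm : forall X, hom X X;
  (* diagrammatic order: [compm f g] is [f] followed by [g] *)
  compm : forall X Y Z, hom X Y -> hom Y Z -> hom X Z;
  comp1m : forall X Y (f : hom X Y), compm (idm X) f = f;
  compm1 : forall X Y (f : hom X Y), compm f (idm Y) = f;
  compmA : forall X Y Z T (f : hom X Y) (g : hom Y Z) (k : hom Z T),
    compm f (compm g k) = compm (compm f g) k }.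

Record functor (C D : category) := Functor {
  fobj :> C -> D;
  fmap : forall X Y, hom X Y -> hom (fobj X) (fobj Y);
  fmap1 : forall X, fmap (idm X) = idm (fobj X);
  fmapM : forall X Y Z (f : hom X Y) (g : hom Y Z),
    fmap (compm f g) = compm (fmap f) (fmap g) }.

Definition idF (C : category) : functor C C :=
  @Functor C C (fun X => X) (fun X Y f => f)
    (fun X => erefl) (fun X Y Z f g => erefl).

Lemma compF_id (C D E : category) (S : functor C D) (T : functor D E) (X : C) :
  fmap T (fmap S (idm X)) = idm (T (S X)).
Proof. by rewrite !fmap1. Qed.

Lemma compF_comp (C D E : category) (S : functor C D) (T : functor D E)
    (X Y Z : C) (f : hom X Y) (g : hom Y Z) :
  fmap T (fmap S (compm f g)) = compm (fmap T (fmap S f)) (fmap T (fmap S g)).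
Proof. by rewrite !fmapM. Qed.

(* [S] followed by [T] *)
Definition compF (C D E : category) (S : functor C D) (T : functor D E) :
    functor C E :=
  @Functor C E (fun X => T (S X)) (fun X Y f => fmap T (fmap S f))
    (compF_id S T) (compF_comp S T).

Definition is_iso (C : category) (X Y : C) (f : hom X Y) : Prop :=
  exists g : hom Y X, compm f g = idm X /\ compm g f = idm Y.

Definition naturally_isomorphic (C D : category) (S T : functor C D) : Prop :=
  exists eta : forall X : C, hom (S X) (T X),
    (forall (X Y : C) (f : hom X Y),
       compm (fmap S f) (eta Y) = compm (eta X) (fmap T f)) /\
    (forall X : C, is_iso (eta X)).

Definition equivalent_categories (C D : category) : Prop :=
  exists (S : functor C D) (T : functor D C),
    naturally_isomorphic (compF S T) (idF C) /\
    naturally_isomorphic (compF T S) (idF D).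

(* The product is not required to have a unit. *)
Record poisson (F : fieldType) := Poisson {
  psort :> lmodType F;
  pmul : {bilinear psort -> psort -> psort};
  pbr : {bilinear psort -> psort -> psort};
  pmulC : forall x y, pmul x y = pmul y x;
  pmulA : forall x y z, pmul x (pmul y z) = pmul (pmul x y) z;
  pbrxx : forall x, pbr x x = 0;
  pbr_jacobi : forall x y z,
    pbr x (pbr y z) + pbr y (pbr z x) + pbr z (pbr x y) = 0;
  pbr_leibniz : forall x y z,
    pbr (pmul x y) z = pmul (pbr x z) y + pmul x (pbr y z) }.

Declare Scope poisson_scope.
Delimit Scope poisson_scope with P.
Notation "x ** y" := (pmul _ x y)
  (at level 40, left associativity) : poisson_scope.
Notation "{[ x , y ]}" := (pbr _ x y)
  (at level 0, x, y at level 99, format "{[ x ,  y ]}") : poisson_scope.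
Local Open Scope poisson_scope.

Record phom (F : fieldType) (P Q : poisson F) := PHom {
  phom_lin :> {linear P -> Q};
  phomM : forall x y, phom_lin (x ** y) = phom_lin x ** phom_lin y;
  phomB : forall x y, phom_lin {[x, y]} = {[phom_lin x, phom_lin y]} }.

Record pder (F : fieldType) (P : poisson F) := PDer {
  pder_lin :> {linear P -> P};
  pderM : forall x y, pder_lin (x ** y) = pder_lin x ** y + x ** pder_lin y;
  pderB : forall x y,
    pder_lin {[x, y]} = {[pder_lin x, y]} + {[x, pder_lin y]} }.

(* Proves an equality of two sums that agree up to reordering their terms. *)
Ltac sum_match :=
  rewrite -?addrA;
  repeat match goal with
  | |- _ = ?a + _ =>
    rewrite ?[in LHS](addrC _ a); rewrite ?[in LHS](addrCA _ a);
    apply: (congr1 (+%R a))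
  end.

Section PoissonHom.
Variable F : fieldType.

Lemma linear_ext (U V : lmodType F) (u v : {linear U -> V}) : u =1 v -> u = v.
Proof.
case: u v => u [[u1] [u2]] [v [[v1] [v2]]] /= /funext e.
move: u1 u2 v1 v2; rewrite e => u1 u2 v1 v2.
by rewrite (Prop_irrelevance u1 v1) (Prop_irrelevance u2 v2).
Qed.

Lemma phom_ext (P Q : poisson F) (u v : phom P Q) : u =1 v -> u = v.
Proof.
case: u v => u u1 u2 [v v1 v2] /= /linear_ext e.
move: u1 u2 v1 v2; rewrite e => u1 u2 v1 v2.
by rewrite (Prop_irrelevance u1 v1) (Prop_irrelevance u2 v2).
Qed.

Definition phom_id (P : poisson F) : phom P P :=
  @PHom F P P (idfun : {linear P -> P})
    (fun x y => erefl) (fun x y => erefl).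

Section Comp.
Variables (P Q R : poisson F) (u : phom P Q) (v : phom Q R).
Let w : {linear P -> R} := v \o u.

Lemma phom_compM x y : w (x ** y) = w x ** w y.
Proof. by rewrite /= !phomM. Qed.

Lemma phom_compB x y : w {[x, y]} = {[w x, w y]}.
Proof. by rewrite /= !phomB. Qed.

(* [u] followed by [v] *)
Definition phom_comp : phom P R := PHom phom_compM phom_compB.
End Comp.

Lemma pbrC (P : poisson F) (x y : P) : {[x, y]} = - {[y, x]}.
Proof.
apply/eqP; rewrite -addr_eq0; apply/eqP.
have := pbrxx (x + y).
by rewrite linearDl !linearDr /= !pbrxx add0r addr0.
Qed.

End PoissonHom.

Section EXT.
Variable F : fieldType.

Record extension := Extension {
  ext_sub : poisson F;
  ext_mid : poisson F;
  ext_quo : poisson F;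
  ext_inj : phom ext_sub ext_mid;
  ext_proj : phom ext_mid ext_quo;
  ext_inj_injective : injective ext_inj;
  ext_exact : forall p, ext_proj p = 0 <-> exists a, p = ext_inj a;
  ext_proj_surjective : forall x, exists p, ext_proj p = x }.

Record ext_mor (E1 E2 : extension) := ExtMor {
  ext_lam : phom (ext_sub E1) (ext_sub E2);
  ext_mu : phom (ext_mid E1) (ext_mid E2);
  ext_nu : phom (ext_quo E1) (ext_quo E2);
  ext_mor_inj : forall a, ext_mu (ext_inj E1 a) = ext_inj E2 (ext_lam a);
  ext_mor_proj : forall p, ext_nu (ext_proj E1 p) = ext_proj E2 (ext_mu p) }.

Lemma ext_mor_ext (E1 E2 : extension) (u v : ext_mor E1 E2) :
  ext_lam u =1 ext_lam v -> ext_mu u =1 ext_mu v -> ext_nu u =1 ext_nu v ->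
  u = v.
Proof.
case: u v => l m n p q [l' m' n' p' q'] /=.
move=> /phom_ext el /phom_ext em /phom_ext en.
move: p q p' q'; rewrite el em en => p q p' q'.
by rewrite (Prop_irrelevance p p') (Prop_irrelevance q q').
Qed.

Definition ext_id (E : extension) : ext_mor E E :=
  @ExtMor E E (phom_id _) (phom_id _) (phom_id _)
    (fun a => erefl) (fun p => erefl).

Section Comp.
Variables (E1 E2 E3 : extension) (u : ext_mor E1 E2) (v : ext_mor E2 E3).

Lemma ext_comp_inj a :
  phom_comp (ext_mu u) (ext_mu v) (ext_inj E1 a) =
  ext_inj E3 (phom_comp (ext_lam u) (ext_lam v) a).
Proof. by rewrite /= !ext_mor_inj. Qed.

Lemma ext_comp_proj p :
  phom_comp (ext_nu u) (ext_nu v) (ext_proj E1 p) =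
  ext_proj E3 (phom_comp (ext_mu u) (ext_mu v) p).
Proof. by rewrite /= !ext_mor_proj. Qed.

Definition ext_comp : ext_mor E1 E3 := ExtMor ext_comp_inj ext_comp_proj.
End Comp.

Lemma ext_comp1m (E1 E2 : extension) (u : ext_mor E1 E2) :
  ext_comp (ext_id E1) u = u.
Proof. exact: ext_mor_ext. Qed.

Lemma ext_compm1 (E1 E2 : extension) (u : ext_mor E1 E2) :
  ext_comp u (ext_id E2) = u.
Proof. exact: ext_mor_ext. Qed.

Lemma ext_compA (E1 E2 E3 E4 : extension)
    (u : ext_mor E1 E2) (v : ext_mor E2 E3) (w : ext_mor E3 E4) :
  ext_comp u (ext_comp v w) = ext_comp (ext_comp u v) w.
Proof. exact: ext_mor_ext. Qed.

Definition EXT : category := Category ext_comp1m ext_compm1 ext_compA.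

End EXT.

(* The spaces of linear maps and of derivations carry the pointwise operations,
   so linearity of [fs_gam] and [fs_Gam] is stated after evaluation at [a]. *)
Record factor_system (F : fieldType) := FactorSystem {
  fs_H : poisson F;
  fs_K : poisson F;
  fs_f : {bilinear fs_K -> fs_K -> fs_H};
  fs_h : {bilinear fs_K -> fs_K -> fs_H};
  fs_gam : fs_K -> {linear fs_H -> fs_H};
  fs_Gam : fs_K -> pder fs_H;
  fs_f_sym : forall x y, fs_f x y = fs_f y x;
  fs_h_alt : forall x, fs_h x x = 0;
  fs_gam_linear : forall a, linear (fun x => fs_gam x a);
  fs_Gam_linear : forall a, linear (fun x => fs_Gam x a);
  fs_gam_mul : forall x y a,
    fs_gam (x ** y) a = fs_gam y (fs_gam x a) - a ** fs_f x y /\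
    fs_gam (x ** y) a = fs_gam x (fs_gam y a) - a ** fs_f x y;
  fs_gam_br : forall x y a,
    fs_gam {[x, y]} a =
    fs_Gam y (fs_gam x (- a)) + fs_gam x (fs_Gam y a) - a ** fs_h x y;
  fs_gamM : forall x a b,
    fs_gam x (a ** b) = a ** fs_gam x b /\
    fs_gam x (a ** b) = b ** fs_gam x a;
  fs_gamB : forall x a b,
    fs_gam x {[a, b]} = {[fs_gam x a, b]} - a ** fs_Gam x b;
  fs_Gam_mul : forall x y a,
    fs_Gam (x ** y) a =
    fs_gam y (fs_Gam x a) + fs_gam x (fs_Gam y a) + {[a, fs_f x y]};
  fs_Gam_br : forall x y a,
    fs_Gam {[x, y]} a =
    fs_Gam x (fs_Gam y a) - fs_Gam y (fs_Gam x a) - {[fs_h x y, a]};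
  fs_f_assoc : forall x y z,
    fs_gam z (fs_f x y) + fs_f (x ** y) z =
    fs_gam x (fs_f y z) + fs_f x (y ** z);
  fs_h_jacobi : forall x y z,
    fs_h {[x, y]} z + fs_h {[y, z]} x + fs_h {[z, x]} y =
    fs_Gam z (fs_h x y) + fs_Gam x (fs_h y z) + fs_Gam y (fs_h z x);
  fs_h_leibniz : forall x y z,
    fs_h (x ** y) z =
    fs_Gam z (fs_f x y) + fs_gam y (fs_h x z) + fs_f {[x, z]} y +
    fs_gam x (fs_h y z) + fs_f x {[y, z]} }.

Arguments fs_f {F} S : rename.
Arguments fs_h {F} S : rename.
Arguments fs_gam {F} S x : rename.
Arguments fs_Gam {F} S x : rename.

Section FAC.
Variable F : fieldType.

Definition fac_A (S1 S2 : factor_system F) (g : fs_K S1 -> fs_H S2)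
    (nu : fs_K S1 -> fs_K S2) (u z : fs_K S1) : fs_H S2 :=
  fs_h S2 (nu u) (nu z) + fs_Gam S2 (nu u) (g z) - fs_Gam S2 (nu z) (g u)
  + {[g u, g z]}.

Record fac_mor (S1 S2 : factor_system F) := FacMor {
  fac_lam : phom (fs_H S1) (fs_H S2);
  fac_g : {linear fs_K S1 -> fs_H S2};
  fac_nu : phom (fs_K S1) (fs_K S2);
  fac_hE : forall x y,
    fs_h S2 (fac_nu x) (fac_nu y) + fs_Gam S2 (fac_nu x) (fac_g y)
      - fs_Gam S2 (fac_nu y) (fac_g x) + {[fac_g x, fac_g y]} =
    fac_g {[x, y]} + fac_lam (fs_h S1 x y);
  fac_GamE : forall x a,
    fac_lam (fs_Gam S1 x a) =
    fs_Gam S2 (fac_nu x) (fac_lam a) + {[fac_g x, fac_lam a]};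
  fac_fE : forall x y,
    fac_lam (fs_f S1 x y) + fac_g (x ** y) =
    fac_g x ** fac_g y + fs_gam S2 (fac_nu y) (fac_g x)
      + fs_gam S2 (fac_nu x) (fac_g y) + fs_f S2 (fac_nu x) (fac_nu y);
  fac_gamE : forall x a,
    fac_lam (fs_gam S1 x a) =
    fac_lam a ** fac_g x + fs_gam S2 (fac_nu x) (fac_lam a);
  fac_leibnizE : forall x y z,
    let A := fac_A fac_g fac_nu in
    fac_g {[x ** y, z]} - fac_lam (fs_Gam S1 z (fs_f S1 x y))
      + fac_lam (fs_h S1 (x ** y) z) =
    A x z ** fac_g y + fs_gam S2 (fac_nu y) (A x z)
      + fs_gam S2 (fac_nu {[x, z]}) (fac_g y)
      + fs_f S2 (fac_nu {[x, z]}) (fac_nu y)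
      + fac_g x ** A y z + fs_gam S2 (fac_nu {[y, z]}) (fac_g x)
      + fs_gam S2 (fac_nu x) (A y z)
      + fs_f S2 (fac_nu x) (fac_nu {[y, z]}) }.

Lemma fac_mor_ext (S1 S2 : factor_system F) (u v : fac_mor S1 S2) :
  fac_lam u =1 fac_lam v -> fac_g u =1 fac_g v -> fac_nu u =1 fac_nu v ->
  u = v.
Proof.
case: u v => l g n p1 p2 p3 p4 p5 [l' g' n' q1 q2 q3 q4 q5] /=.
move=> /phom_ext el /linear_ext eg /phom_ext en.
move: p1 p2 p3 p4 p5 q1 q2 q3 q4 q5; rewrite el eg en => *.
by congr FacMor; exact: Prop_irrelevance.
Qed.

(* The last condition on morphisms follows from the other four. *)
Section Leibniz.
Variables (S1 S2 : factor_system F) (lam : phom (fs_H S1) (fs_H S2)).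
Variables (g : {linear fs_K S1 -> fs_H S2}) (nu : phom (fs_K S1) (fs_K S2)).
Hypothesis hE : forall x y,
  fac_A g nu x y = g {[x, y]} + lam (fs_h S1 x y).
Hypothesis fE : forall x y,
  lam (fs_f S1 x y) + g (x ** y) =
  g x ** g y + fs_gam S2 (nu y) (g x)
    + fs_gam S2 (nu x) (g y) + fs_f S2 (nu x) (nu y).
Hypothesis gamE : forall x a,
  lam (fs_gam S1 x a) = lam a ** g x + fs_gam S2 (nu x) (lam a).

Lemma fac_leibniz_of x y z :
  let A := fac_A g nu in
  g {[x ** y, z]} - lam (fs_Gam S1 z (fs_f S1 x y))
    + lam (fs_h S1 (x ** y) z) =
  A x z ** g y + fs_gam S2 (nu y) (A x z)
    + fs_gam S2 (nu {[x, z]}) (g y)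
    + fs_f S2 (nu {[x, z]}) (nu y)
    + g x ** A y z + fs_gam S2 (nu {[y, z]}) (g x)
    + fs_gam S2 (nu x) (A y z)
    + fs_f S2 (nu x) (nu {[y, z]}).
Proof.
move=> A; rewrite /A !hE fs_h_leibniz pbr_leibniz !linearD /= !gamE.
have e1 := fE {[x, z]} y; have e2 := fE x {[y, z]}.
rewrite linearDl /= [g x ** lam _]pmulC !addrA subrK.
set l1 := lam (fs_f S1 {[x, z]} y) in e1 *.
set l2 := lam (fs_f S1 x {[y, z]}) in e2 *.
transitivity ((l1 + g ({[x, z]} ** y)) + (l2 + g (x ** {[y, z]}))
  + lam (fs_h S1 x z) ** g y + fs_gam S2 (nu y) (lam (fs_h S1 x z))
  + lam (fs_h S1 y z) ** g x + fs_gam S2 (nu x) (lam (fs_h S1 y z))).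
  by sum_match.
by rewrite e1 e2; sum_match.
Qed.
End Leibniz.

Section Comp.
Variables (S1 S2 S3 : factor_system F) (u : fac_mor S1 S2) (v : fac_mor S2 S3).
Let lam := phom_comp (fac_lam u) (fac_lam v).
Let nu := phom_comp (fac_nu u) (fac_nu v).

Definition fac_comp_g : {linear fs_K S1 -> fs_H S3} :=
  (fac_g v \o fac_nu u) \+ (fac_lam v \o fac_g u).

Let g := fac_comp_g.

Lemma fac_comp_hE x y :
  fs_h S3 (nu x) (nu y) + fs_Gam S3 (nu x) (g y) - fs_Gam S3 (nu y) (g x)
    + {[g x, g y]} = g {[x, y]} + lam (fs_h S1 x y).
Proof.
have e1 := fac_hE v (fac_nu u x) (fac_nu u y).
have := congr1 (fac_lam v) (fac_hE u x y).
rewrite !linearD linearN /= !fac_GamE phomB opprD.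
rewrite -[- {[fac_g v _, fac_lam v _]}]pbrC => e2.
rewrite /g /= phomB.
apply: (addIr (fac_lam v (fs_h S2 (fac_nu u x) (fac_nu u y)))).
transitivity ((fac_g v {[fac_nu u x, fac_nu u y]}
    + fac_lam v (fs_h S2 (fac_nu u x) (fac_nu u y)))
  + (fac_lam v (fac_g u {[x, y]}) + fac_lam v (fac_lam u (fs_h S1 x y)))).
  by rewrite -e1 -e2 !linearDl; sum_match.
by sum_match.
Qed.

Lemma fac_comp_GamE x a :
  lam (fs_Gam S1 x a) = fs_Gam S3 (nu x) (lam a) + {[g x, lam a]}.
Proof. by rewrite /= fac_GamE linearD /= fac_GamE phomB linearDl /= addrA. Qed.

Lemma fac_comp_fE x y :
  lam (fs_f S1 x y) + g (x ** y) =
  g x ** g y + fs_gam S3 (nu y) (g x)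
    + fs_gam S3 (nu x) (g y) + fs_f S3 (nu x) (nu y).
Proof.
have e1 := fac_fE v (fac_nu u x) (fac_nu u y).
have := congr1 (fac_lam v) (fac_fE u x y).
rewrite !linearD /= !fac_gamE phomM.
rewrite [fac_lam v (fac_g u y) ** fac_g v _]pmulC => e2.
rewrite /g /= phomM.
apply: (addIr (fac_lam v (fs_f S2 (fac_nu u x) (fac_nu u y)))).
transitivity ((fac_lam v (fs_f S2 (fac_nu u x) (fac_nu u y))
    + fac_g v (fac_nu u x ** fac_nu u y))
  + (fac_lam v (fac_lam u (fs_f S1 x y)) + fac_lam v (fac_g u (x ** y)))).
  by sum_match.
by rewrite e1 e2 !linearDl; sum_match.
Qed.

Lemma fac_comp_gamE x a :
  lam (fs_gam S1 x a) = lam a ** g x + fs_gam S3 (nu x) (lam a).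
Proof.
rewrite /= fac_gamE linearD /= fac_gamE phomM linearDr /= addrA.
by rewrite [in RHS](addrC (_ ** fac_g v _)).
Qed.

Definition fac_comp : fac_mor S1 S3 :=
  FacMor fac_comp_hE fac_comp_GamE fac_comp_fE fac_comp_gamE
    (fac_leibniz_of fac_comp_hE fac_comp_fE fac_comp_gamE).
End Comp.

Section Id.
Variable S : factor_system F.
Let lam := phom_id (fs_H S).
Let nu := phom_id (fs_K S).
Let g : {linear fs_K S -> fs_H S} := \0.

Lemma fac_id_hE x y :
  fs_h S (nu x) (nu y) + fs_Gam S (nu x) (g y) - fs_Gam S (nu y) (g x)
    + {[g x, g y]} = g {[x, y]} + lam (fs_h S x y).
Proof. by rewrite /= !linear0 ?oppr0 !addr0 add0r. Qed.

Lemma fac_id_GamE x a :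
  lam (fs_Gam S x a) = fs_Gam S (nu x) (lam a) + {[g x, lam a]}.
Proof. by rewrite /= linear0l addr0. Qed.

Lemma fac_id_fE x y :
  lam (fs_f S x y) + g (x ** y) =
  g x ** g y + fs_gam S (nu y) (g x)
    + fs_gam S (nu x) (g y) + fs_f S (nu x) (nu y).
Proof. by rewrite /= !linear0 !addr0 !add0r. Qed.

Lemma fac_id_gamE x a :
  lam (fs_gam S x a) = lam a ** g x + fs_gam S (nu x) (lam a).
Proof. by rewrite /= linear0r add0r. Qed.

Definition fac_id : fac_mor S S :=
  FacMor fac_id_hE fac_id_GamE fac_id_fE fac_id_gamE
    (fac_leibniz_of fac_id_hE fac_id_fE fac_id_gamE).
End Id.

Lemma fac_comp1m (S1 S2 : factor_system F) (u : fac_mor S1 S2) :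
  fac_comp (fac_id S1) u = u.
Proof. by apply: fac_mor_ext => // x /=; rewrite linear0 addr0. Qed.

Lemma fac_compm1 (S1 S2 : factor_system F) (u : fac_mor S1 S2) :
  fac_comp u (fac_id S2) = u.
Proof. by apply: fac_mor_ext => // x /=; rewrite add0r. Qed.

Lemma fac_compA (S1 S2 S3 S4 : factor_system F)
    (u : fac_mor S1 S2) (v : fac_mor S2 S3) (w : fac_mor S3 S4) :
  fac_comp u (fac_comp v w) = fac_comp (fac_comp u v) w.
Proof. by apply: fac_mor_ext => // x /=; rewrite linearD addrA. Qed.

Definition FAC : category := Category fac_comp1m fac_compm1 fac_compA.

End FAC.

(* Main.v *)
From HB Require Import structures.
From mathcomp Require Import all_boot all_algebra.
From mathcomp Require Import boolp classical_sets.
Require Import Defs.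

Set Implicit Arguments.
Unset Strict Implicit.
Unset Printing Implicit Defensive.

Import GRing.Theory.
Local Open Scope ring_scope.
Local Open Scope poisson_scope.

(** An extension 0 -> H -> P -> K -> 0 splits as a sequence of vector spaces.
Choosing a linear section [s] of P -> K identifies P with H x K, by sending
(a, x) to a + s x, and the two operations of P then become

- (a, x)(b, y) = (ab + gam_y a + gam_x b + f(x, y), xy),
- [(a, x), (b, y)] = ([a, b] + Gam_x b - Gam_y a + h(x, y), [x, y]),

where gam_x and Gam_x are the product and the bracket with [s x], restricted to
the ideal H, while f and h measure the failure of [s] to be multiplicative and
to be a Lie homomorphism. The axioms of a factor system are what associativity,
the Jacobi identity and the Leibniz rule of P say in these coordinates, so they
hold for the data extracted from P ([efs]), and conversely they turn H x K into
a Poisson algebra ([crossed_product]). A morphism of extensions reads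
(a, x) |-> (lam a + g x, nu x) in these coordinates, and being a Poisson
homomorphism amounts to the conditions on (lam, g, nu).

The equivalence is obtained from the functor FAC -> EXT given by the crossed
product ([crossed_functor]), which involves no choice. It is fully faithful,
because g is recovered as the H-component of the image of (0, x)
([crossed_full_faithful]), and essentially surjective, because every extension
is isomorphic to the crossed product of the factor system read off from a linear
section ([crossed_essentially_surjective]). A fully faithful and essentially
surjective functor is an equivalence ([equivalence_of_ffes]). The vector spaces
may have infinite dimension, so the section itself comes from Zorn's lemma
([linear_section]). *)

(** * Fully faithful, essentially surjective functors *)

Section Equivalence.
Variables (C D : category) (T : functor C D).

Definition full_faithful :=
  forall (X Y : C) (k : hom (T X) (T Y)), exists! f : hom X Y, fmap T f = k.

Definition essentially_surjective :=
  forall Y : D, exists (X : C) (k : hom (T X) Y), is_iso k.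

Lemma full_faithful_inj (X Y : C) (f g : hom X Y) :
  full_faithful -> fmap T f = fmap T g -> f = g.
Proof. by move=> /(_ X Y (fmap T g)) [k [_ ku]] e; rewrite -(ku f) ?(ku g). Qed.

Lemma reflects_iso (X Y : C) (f : hom X Y) :
  full_faithful -> is_iso (fmap T f) -> is_iso f.
Proof.
move=> ff [k [fk kf]]; have [g [gE _]] := ff _ _ k.
by exists g; split; apply: full_faithful_inj; rewrite // fmapM gE fmap1.
Qed.

(** The inverse functor picks for each [Y] an object [G Y] with an isomorphism
[eps Y] from its image to [Y], and sends [k] to the unique preimage of the
conjugate of [k] by these isomorphisms. *)
Lemma equivalence_of_ffes :
  full_faithful -> essentially_surjective -> equivalent_categories D C.
Proof.
move=> ff es.
pose G Y := projT1 (cid (es Y)).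
pose eps Y : hom (T (G Y)) Y := projT1 (cid (projT2 (cid (es Y)))).
have epsP Y : is_iso (eps Y) by exact: projT2 (cid (projT2 (cid (es Y)))).
pose inv Y : hom Y (T (G Y)) := projT1 (cid (epsP Y)).
have [epsK invK] : (forall Y, compm (eps Y) (inv Y) = idm _) *
    (forall Y, compm (inv Y) (eps Y) = idm _).
  by split=> Y; have [] := projT2 (cid (epsP Y)).
pose lift X Y (k : hom (T X) (T Y)) : hom X Y := projT1 (cid (ff X Y k)).
have liftE X Y k : fmap T (@lift X Y k) = k.
  by have [] := projT2 (cid (ff X Y k)).
pose Gmap X Y (k : hom X Y) := lift _ _ (compm (compm (eps X) k) (inv Y)).
have Gmap1 X : Gmap _ _ (idm X) = idm (G X).
  by apply: full_faithful_inj; rewrite // liftE compm1 epsK fmap1.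
have GmapM X Y Z (f : hom X Y) (g : hom Y Z) :
    Gmap _ _ (compm f g) = compm (Gmap _ _ f) (Gmap _ _ g).
  apply: full_faithful_inj => //; rewrite fmapM !liftE !compmA.
  by rewrite -[compm _ (eps Y)]compmA invK compm1.
pose S := Functor Gmap1 GmapM.
exists S, T; split.
  exists eps; split=> // X Y f /=.
  by rewrite liftE -!compmA invK compm1.
exists (fun X => lift _ _ (eps (T X))); split=> [X Y f|X] /=.
  apply: full_faithful_inj => //.
  by rewrite !fmapM !liftE -!compmA invK compm1.
by apply: reflects_iso; rewrite // liftE.
Qed.
End Equivalence.

(** * Linear maps *)

(** A map that is only known to be linear inside a proof, such as one obtained by
choice, cannot be given a canonical structure; this packs it explicitly. *)
Definition linear_of (F : fieldType) (U V : lmodType F) (f : U -> V)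
    (f_lin : linear f) : {linear U -> V} :=
  HB.pack f (GRing.isLinear.Build F U V *:%R f f_lin).

Definition bilinear_of (F : fieldType) (U V W : lmodType F) (f : U -> V -> W)
    (f_linl : forall v, linear (f^~ v)) (f_linr : forall u, linear (f u)) :
    {bilinear U -> V -> W} :=
  HB.pack f
    (bilinear_isBilinear.Build F U V W *:%R *:%R f (f_linl, f_linr)).

Section BilinearComp.
Variables (F : fieldType) (X Y U V W Z : lmodType F).
Variables (op : {bilinear U -> V -> W}) (r : {linear W -> Z}).
Variables (u : {linear X -> U}) (v : {linear Y -> V}).

Let comp2 x y := r (op (u x) (v y)).

Lemma comp2_linl y : linear (comp2^~ y).
Proof. by move=> c x x'; rewrite /comp2 linearP linearPl linearP. Qed.

Lemma comp2_linr x : linear (comp2 x).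
Proof. by move=> c y y'; rewrite /comp2 linearP linearPr linearP. Qed.

Definition bilinear_comp : {bilinear X -> Y -> Z} :=
  bilinear_of comp2_linl comp2_linr.
End BilinearComp.

(** A subspace that is maximal among those meeting the kernel of [b] trivially
is a complement of the kernel: a vector [p] outside their sum could be added to
it. Such a complement is mapped bijectively onto [V]. *)
Lemma linear_section (F : fieldType) (U V : lmodType F) (b : {linear U -> V}) :
  (forall y, exists x, b x = y) -> exists s : {linear V -> U}, cancel s b.
Proof.
move=> b_surj.
(* The empty set qualifies, so that the union of an empty chain does too; a
   maximal set nevertheless contains 0. *)
pose indep (W : set U) := (forall c u v, W u -> W v -> W (c *: u + v)) /\
  forall u, W u -> b u = 0 -> u = 0.
have [W [[Wl Wk] Wmax]] :
    exists W, indep W /\ forall W', (W `<` W')%classic -> ~ indep W'.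
  apply: Zorn_bigcup => /= C Cind Ctot; split=> [c u v [X CX Xu] [Y CY Yv]|u].
    have [XY|YX] := Ctot X Y CX CY.
      by exists Y => //; apply: (Cind _ CY).1 => //; apply: XY.
    by exists X => //; apply: (Cind _ CX).1 => //; apply: YX.
  by move=> [X CX]; apply: (Cind X CX).2.
have W0 : W 0.
  apply: contrapT => nW0; apply: (Wmax [set u | W u \/ u = 0]%classic).
    by split=> [u|/(_ 0) /=]; [left | move=> /(_ (or_intror erefl))].
  split=> [c u v /= [Wu|->] [Wv|->]|u [/Wk|//]//].
  - by left; exact: Wl.
  - by case: nW0; have := Wl (-1) _ _ Wu Wu; rewrite scaleN1r addNr.
  - by left; rewrite scaler0 add0r.
  - by right; rewrite scaler0 add0r.
have WZ c u : W u -> W (c *: u).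
  by move=> Wu; rewrite -[_ *: _]addr0; exact: Wl.
have Wb p : exists w, W w /\ b w = b p.
  apply: contrapT => nWp.
  pose W' : set U := fun u => exists c w, W w /\ u = c *: p + w.
  apply: (Wmax W').
    split=> [w Ww|sub]; first by exists 0, w; rewrite scale0r add0r.
    case: nWp; exists p; split=> //; apply: sub.
    by exists 1, 0; rewrite scale1r addr0.
  split=> [c _ _ [d [w [Ww ->]]] [e [w' [Ww' ->]]]|_ [c [w [Ww ->]]]].
    exists (c * d + e), (c *: w + w'); split; first exact: Wl.
    by rewrite scalerDr scalerA scalerDl addrACA.
  rewrite linearD linearZ /=.
  have [->|c0] := eqVneq c 0; first by rewrite !scale0r !add0r; exact: Wk.
  move=> e; case: nWp; exists (- c^-1 *: w); split; first exact: WZ.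
  apply/eqP; rewrite linearZ /= scaleNr eq_sym -addr_eq0 -(scalerK c0 (b p)).
  by rewrite -scalerDr e scaler0.
have /choice[s sP] y : exists w, W w /\ b w = y.
  by have [p <-] := b_surj y; exact: Wb.
have s_lin : linear s.
  move=> c x y; apply/eqP; rewrite -subr_eq0; apply/eqP; apply: Wk.
    rewrite [X in W X]addrC -scaleN1r; apply: (Wl); last exact: (sP _).1.
    by apply: Wl; exact: (sP _).1.
  by rewrite linearB linearD linearZ /= !(sP _).2 subrr.
by exists (linear_of s_lin) => y; exact: (sP y).2.
Qed.

(** * Identities in abelian groups *)

(** Applied to a known relation [p = q], this adds it to the goal; what remains
is an identity between formal sums when the goal is a consequence of the
relation. *)
Lemma eq_from_sum (V : zmodType) (p q x y : V) :
  p = q -> p + x = q + y -> x = y.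
Proof. by move=> -> /addrI. Qed.

(** Replacing the summands by variables is what makes [abel] fast, since no
rewriting attempt then has to compare compound terms. [move:] also identifies
the occurrences that differ only in the path of their algebraic structures. *)
Ltac abstract_atom t :=
  lazymatch t with
  | ?a + ?b => first [abstract_atom a | abstract_atom b]
  | - ?a => abstract_atom a
  | 0 => fail
  | _ => tryif is_var t then fail else (move: (t) => ?)
  end.

Ltac abstract_atoms :=
  repeat match goal with
  | |- ?l = ?r => first [abstract_atom l | abstract_atom r]
  end.

(** The last summand is not followed by a sum, hence the first rewriting. *)
Ltac pull_to_front t :=
  try rewrite (addrC _ t);
  repeat lazymatch goal with
  | |- t + _ = 0 => fail
  | |- _ => rewrite (addrCA _ t)
  end.

(** Proves an equality of two signed sums that agree up to reordering and
cancellation of their terms. *)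
Ltac abel :=
  abstract_atoms;
  apply/eqP; rewrite -subr_eq0; apply/eqP;
  rewrite ?add0r ?addr0 ?opprD ?opprK -?addrA;
  repeat match goal with
  | |- context [- ?a] =>
    pull_to_front (- a); pull_to_front a;
    first [rewrite addNKr | exact: subrr]
  end.

(** * Identities in Poisson algebras *)

Section PoissonIdentities.
Variables (F : fieldType) (P : poisson F).

Lemma pmulCA (x y z : P) : x ** (y ** z) = y ** (x ** z).
Proof. by rewrite !pmulA [x ** y]pmulC. Qed.

Lemma pbr_leibnizr (x y z : P) : {[x, y ** z]} = {[x, y]} ** z + y ** {[x, z]}.
Proof.
by rewrite pbrC pbr_leibniz ![{[_, x]}]pbrC linearNl linearNr -opprD opprK.
Qed.

Lemma pbr_brl (x y z : P) : {[{[x, y]}, z]} = {[x, {[y, z]}]} - {[y, {[x, z]}]}.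
Proof.
have := pbr_jacobi x y z; rewrite [{[z, {[x, y]}]}]pbrC [{[z, x]}]pbrC linearNr.
by move/eqP; rewrite subr_eq0 => /eqP ->.
Qed.

Lemma phom_inverse (Q : poisson F) (u : phom P Q) (v : Q -> P) :
  injective u -> cancel v u -> exists w : phom Q P, w =1 v.
Proof.
move=> u_inj vK.
have v_lin : linear v by move=> c x y; apply: u_inj; rewrite linearP /= !vK.
pose w := linear_of v_lin.
have wM x y : w (x ** y) = w x ** w y by apply: u_inj; rewrite phomM /= !vK.
have wB x y : w {[x, y]} = {[w x, w y]} by apply: u_inj; rewrite phomB /= !vK.
by exists (PHom wM wB).
Qed.
End PoissonIdentities.

(** * The crossed product of a factor system *)

Section CrossedProduct.
Variables (F : fieldType) (S : factor_system F).
Notation H := (fs_H S).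
Notation K := (fs_K S).
Notation gam := (fs_gam S).
Notation Gam := (fs_Gam S).

Lemma gam0 a : gam 0 a = 0.
Proof. exact: (linear0 (linear_of (@fs_gam_linear F S a))). Qed.

Lemma Gam0 a : Gam 0 a = 0.
Proof. exact: (linear0 (linear_of (@fs_Gam_linear F S a))). Qed.

Definition cp_mul (u v : H * K) : H * K :=
  (u.1 ** v.1 + gam v.2 u.1 + gam u.2 v.1 + fs_f S u.2 v.2, u.2 ** v.2).

Definition cp_br (u v : H * K) : H * K :=
  ({[u.1, v.1]} + Gam u.2 v.1 - Gam v.2 u.1 + fs_h S u.2 v.2, {[u.2, v.2]}).

Lemma cp_mulC u v : cp_mul u v = cp_mul v u.
Proof.
rewrite /cp_mul pmulC fs_f_sym [in X in (_, X)]pmulC.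
by congr (_ + _, _); rewrite addrAC.
Qed.

Lemma cp_mul_linr u : linear (cp_mul u).
Proof.
move=> c v w; congr (_, _) => /=; last by rewrite linearPr.
have /= -> := @fs_gam_linear F S u.1 c v.2 w.2.
rewrite !linearPr linearP /= !scalerDr.
by sum_match.
Qed.

Lemma cp_mul_linl v : linear (cp_mul^~ v).
Proof. by move=> c u w; rewrite ![cp_mul _ v]cp_mulC cp_mul_linr. Qed.

Lemma cp_br_linr u : linear (cp_br u).
Proof.
move=> c v w; congr (_, _) => /=; last by rewrite linearPr.
have /= -> := @fs_Gam_linear F S u.1 c v.2 w.2.
rewrite opprD !linearPr linearP /= !scalerDr scalerN.
by sum_match.
Qed.

Lemma fs_hC x y : fs_h S x y = - fs_h S y x.
Proof.
apply/eqP; rewrite -addr_eq0; apply/eqP.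
have := fs_h_alt (x + y).
by rewrite linearDl !linearDr /= !fs_h_alt add0r addr0.
Qed.

Lemma cp_brC u v : cp_br u v = - cp_br v u.
Proof.
congr (_, _) => /=; last exact: pbrC.
by rewrite pbrC fs_hC; abel.
Qed.

Lemma cp_br_linl v : linear (cp_br^~ v).
Proof.
by move=> c u w; rewrite ![cp_br _ v]cp_brC cp_br_linr opprD scalerN.
Qed.

Definition cp_mulL := bilinear_of cp_mul_linl cp_mul_linr.
Definition cp_brL := bilinear_of cp_br_linl cp_br_linr.

Lemma gam_mulr x a b : a ** gam x b = gam x (a ** b).
Proof. by rewrite (fs_gamM x a b).1. Qed.

Lemma gam_mull x a b : gam x a ** b = gam x (a ** b).
Proof. by rewrite pmulC -(fs_gamM x a b).2. Qed.

(** The product axiom of a factor system has two forms, one for each order of [x]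
and [y]; comparing them gives the commutation. *)
Lemma gam_gamC x y a : gam x (gam y a) = gam y (gam x a).
Proof.
apply: (addIr (- (a ** fs_f S x y))).
by rewrite -(fs_gam_mul x y a).1 -(fs_gam_mul x y a).2.
Qed.

(** The axioms on gam reduce the terms involving H to products in H and
iterated gam; the terms in f alone agree by the cocycle identity
[fs_f_assoc]. *)
Lemma cp_mulA u v w : cp_mul u (cp_mul v w) = cp_mul (cp_mul u v) w.
Proof.
case: u v w => [a x] [b y] [c z]; congr (_, _) => /=; last exact: pmulA.
rewrite !linearDl !linearDr !linearD /=.
rewrite (fs_gam_mul y z a).1 (fs_gam_mul x y c).2 (gam_gamC x z b).
rewrite !gam_mull !gam_mulr pmulA [_ ** b ** c]pmulC [fs_f _ _ _ ** c]pmulC.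
by apply: (eq_from_sum (fs_f_assoc x y z)); abel.
Qed.

Lemma cp_brxx u : cp_br u u = 0.
Proof.
case: u => a x; congr (_, _) => /=; last exact: pbrxx.
by rewrite pbrxx fs_h_alt add0r addr0 subrr.
Qed.

Lemma cp_jacobi u v w :
  cp_br u (cp_br v w) + cp_br v (cp_br w u) + cp_br w (cp_br u v) = 0.
Proof.
case: u v w => [a x] [b y] [c z]; congr (_, _) => /=; last exact: pbr_jacobi.
rewrite !linearDr !linearNr !linearD !linearN /= !pderB !fs_Gam_br.
(* Brackets and values of h are written with their arguments in the order of
   the axioms, so that opposite terms become visibly opposite. *)
rewrite [fs_h S x {[_, _]}]fs_hC [fs_h S y {[_, _]}]fs_hC.
rewrite [fs_h S z {[_, _]}]fs_hC.
rewrite ![{[fs_h S _ _, _]}]pbrC ![{[Gam _ _, _]}]pbrC.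
apply: (eq_from_sum (fs_h_jacobi x y z)).
apply: (eq_from_sum (esym (pbr_jacobi a b c))).
by abel.
Qed.

Lemma cp_leibniz u v w :
  cp_br (cp_mul u v) w = cp_mul (cp_br u w) v + cp_mul u (cp_br v w).
Proof.
case: u v w => [a x] [b y] [c z]; congr (_, _) => /=; last exact: pbr_leibniz.
rewrite !linearDl !linearDr !linearNl !linearNr !linearD !linearN /=.
rewrite !fs_gam_br !fs_Gam_mul !fs_gamB fs_h_leibniz pderM pbr_leibniz.
rewrite !linearN /=.
rewrite [Gam x c ** b]pmulC [fs_h S x z ** b]pmulC [{[c, _]}]pbrC.
by abel.
Qed.

Definition crossed_product : poisson F :=
  @Poisson F _ cp_mulL cp_brL cp_mulC cp_mulA cp_brxx cp_jacobi cp_leibniz.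
End CrossedProduct.

Section CrossedExtension.
Variables (F : fieldType) (S : factor_system F).
Notation P := (crossed_product S).

Definition cp_inj_fun (a : fs_H S) : P := (a, 0).
Definition cp_proj_fun (p : P) : fs_K S := p.2.

Lemma cp_inj_linear : linear cp_inj_fun.
Proof. by move=> c a b; congr (_, _); rewrite /= scaler0 addr0. Qed.
Lemma cp_proj_linear : linear cp_proj_fun.
Proof. by []. Qed.

Definition cp_injL := linear_of cp_inj_linear.
Definition cp_projL := linear_of cp_proj_linear.

Lemma cp_injM a b : cp_injL (a ** b) = cp_injL a ** cp_injL b.
Proof. by congr (_, _); rewrite /= ?gam0 ?linear0r ?addr0. Qed.
Lemma cp_injB a b : cp_injL {[a, b]} = {[cp_injL a, cp_injL b]}.
Proof. by congr (_, _); rewrite /= ?Gam0 ?linear0r ?subr0 ?addr0. Qed.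

Definition cp_inj : phom (fs_H S) P := PHom cp_injM cp_injB.
Definition cp_proj : phom P (fs_K S) :=
  @PHom F P (fs_K S) cp_projL (fun _ _ => erefl) (fun _ _ => erefl).

Lemma cp_inj_injective : injective cp_inj.
Proof. by move=> a b []. Qed.

Lemma cp_exact p : cp_proj p = 0 <-> exists a, p = cp_inj a.
Proof. by split=> [|[a ->]//]; case: p => a x /= ->; exists a. Qed.

Lemma cp_proj_surjective x : exists p, cp_proj p = x.
Proof. by exists (0, x). Qed.

Definition crossed_extension : extension F :=
  Extension cp_inj_injective cp_exact cp_proj_surjective.
End CrossedExtension.

(** * Morphisms of crossed products *)

Section CrossedMorphism.
Variables (F : fieldType) (S1 S2 : factor_system F) (m : fac_mor S1 S2).
Notation P1 := (crossed_product S1).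
Notation P2 := (crossed_product S2).
Notation lam := (fac_lam m).
Notation g := (fac_g m).
Notation nu := (fac_nu m).

Definition crossed_map (p : P1) : P2 := (lam p.1 + g p.2, nu p.2).

Lemma crossed_map_linear : linear crossed_map.
Proof.
by move=> c p q; congr (_, _); rewrite /= !linearP //= scalerDr addrACA.
Qed.

Definition crossed_mapL := linear_of crossed_map_linear.

Lemma crossed_mapM p q :
  crossed_mapL (p ** q) = crossed_mapL p ** crossed_mapL q.
Proof.
case: p q => [a x] [b y]; congr (_, _) => /=; last exact: phomM.
rewrite !linearDl !linearDr !linearD /= phomM !fac_gamE.
apply: (eq_from_sum (esym (fac_fE m x y))).
rewrite [g x ** lam b]pmulC.
by abel.
Qed.

Lemma crossed_mapB p q :
  crossed_mapL {[p, q]} = {[crossed_mapL p, crossed_mapL q]}.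
Proof.
case: p q => [a x] [b y]; congr (_, _) => /=; last exact: phomB.
rewrite !linearDl !linearDr !linearD linearN /= phomB !fac_GamE.
apply: (eq_from_sum (fac_hE m x y)).
rewrite [{[lam a, g y]}]pbrC.
by abel.
Qed.

Definition crossed_phom : phom P1 P2 := PHom crossed_mapM crossed_mapB.

Lemma crossed_phom_inj a : crossed_phom (cp_inj S1 a) = cp_inj S2 (lam a).
Proof. by congr (_, _); rewrite /= linear0 ?addr0. Qed.

Definition crossed_mor :
  ext_mor (crossed_extension S1) (crossed_extension S2) :=
  @ExtMor F (crossed_extension S1) (crossed_extension S2) lam crossed_phom nu
    crossed_phom_inj (fun _ => erefl).
End CrossedMorphism.

Lemma crossed_mor1 (F : fieldType) (S : FAC F) :
  crossed_mor (fac_id S) = ext_id (crossed_extension S).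
Proof. by apply: ext_mor_ext => // -[a x]; congr (_, _); rewrite /= addr0. Qed.

Lemma crossed_morM (F : fieldType) (S1 S2 S3 : FAC F) (m : fac_mor S1 S2)
    (n : fac_mor S2 S3) :
  crossed_mor (fac_comp m n) = ext_comp (crossed_mor m) (crossed_mor n).
Proof.
apply: ext_mor_ext => // -[a x]; congr (_, _).
by rewrite /= linearD; sum_match.
Qed.

Definition crossed_functor (F : fieldType) : functor (FAC F) (EXT F) :=
  @Functor (FAC F) (EXT F) (@crossed_extension F) (@crossed_mor F)
    (@crossed_mor1 F) (@crossed_morM F).

Section FullFaithful.
Variables (F : fieldType) (S1 S2 : factor_system F).
Variable k : ext_mor (crossed_extension S1) (crossed_extension S2).
Notation lam := (ext_lam k : phom (fs_H S1) (fs_H S2)).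
Notation nu := (ext_nu k : phom (fs_K S1) (fs_K S2)).
Notation mu := (ext_mu k : phom (crossed_product S1) (crossed_product S2)).

(** As [mu] lies over [nu], it sends (0, x) into the fibre over [nu x]; the drift
is the difference with (0, nu x). It is the map g of the morphism of factor
systems that induces [k]. *)
Definition drift_fun (x : fs_K S1) : fs_H S2 := (mu (0, x)).1.

Lemma drift_linear : linear drift_fun.
Proof.
move=> c x y; rewrite /drift_fun.
have -> : (0, c *: x + y) = c *: (0, x) + (0, y) :> crossed_product S1.
  by congr (_, _); rewrite /= scaler0 addr0.
by rewrite linearP.
Qed.

Definition drift := linear_of drift_linear.

Lemma drift0 : drift_fun 0 = 0.
Proof. exact: (linear0 drift). Qed.

Lemma mu_crossed a x : mu (a, x) = (lam a + drift x, nu x).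
Proof.
have mu0x : mu (0, x) = (drift x, nu x).
  by apply: injective_projections => //=; rewrite -(ext_mor_proj k (0, x)).
have -> : (a, x) = (a, 0) + (0, x) :> crossed_product S1.
  by congr (_, _); rewrite /= ?addr0 ?add0r.
rewrite linearD mu0x [mu (a, 0)](ext_mor_inj k a).
by congr (_, _); rewrite /= add0r.
Qed.

(** These are the first components of [phomM mu] and [phomB mu]. The conditions
on a morphism of factor systems follow by setting two of the four arguments to
zero. *)
Lemma lam_cp_mul a x b y :
  lam (cp_mul (a, x) (b, y)).1 + drift (x ** y) =
  (cp_mul (lam a + drift x, nu x) (lam b + drift y, nu y)).1.
Proof.
by have := phomM mu (a, x) (b, y); rewrite !mu_crossed => /(congr1 fst).
Qed.

Lemma lam_cp_br a x b y :
  lam (cp_br (a, x) (b, y)).1 + drift {[x, y]} =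
  (cp_br (lam a + drift x, nu x) (lam b + drift y, nu y)).1.
Proof.
by have := phomB mu (a, x) (b, y); rewrite !mu_crossed => /(congr1 fst).
Qed.

Lemma drift_hE x y : fac_A drift nu x y = drift {[x, y]} + lam (fs_h S1 x y).
Proof.
have := lam_cp_br 0 x 0 y.
rewrite /= !linear0 !add0r ?linear0l ?subr0 ?add0r addrC => ->.
by rewrite /fac_A; sum_match.
Qed.

Lemma drift_fE x y :
  lam (fs_f S1 x y) + drift (x ** y) =
  drift x ** drift y + fs_gam S2 (nu y) (drift x) + fs_gam S2 (nu x) (drift y)
    + fs_f S2 (nu x) (nu y).
Proof.
by have := lam_cp_mul 0 x 0 y; rewrite /= !linear0 !add0r ?linear0l ?add0r.
Qed.

Lemma drift_GamE x a :
  lam (fs_Gam S1 x a) = fs_Gam S2 (nu x) (lam a) + {[drift x, lam a]}.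
Proof.
have := lam_cp_br 0 x a 0.
rewrite /= !linear0 !linear0l !Gam0 drift0 !subr0 !addr0 !add0r => ->.
by rewrite addrC.
Qed.

Lemma drift_gamE x a :
  lam (fs_gam S1 x a) = lam a ** drift x + fs_gam S2 (nu x) (lam a).
Proof.
have := lam_cp_mul 0 x a 0.
rewrite /= !linear0 !linear0l !gam0 drift0 !add0r !addr0 => ->.
by rewrite pmulC.
Qed.

Definition drift_mor : fac_mor S1 S2 :=
  FacMor drift_hE drift_GamE drift_fE drift_gamE
    (fac_leibniz_of drift_hE drift_fE drift_gamE).

Lemma crossed_drift_mor : crossed_mor drift_mor = k.
Proof. by apply: ext_mor_ext => // -[a x]; rewrite mu_crossed. Qed.
End FullFaithful.

Lemma crossed_full_faithful (F : fieldType) :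
  full_faithful (crossed_functor F).
Proof.
move=> S1 S2 k; exists (drift_mor k); split; first exact: crossed_drift_mor.
move=> m <-; apply: fac_mor_ext => // x.
by rewrite /= /drift_fun /= linear0 add0r.
Qed.

(** * The factor system of an extension with a linear section *)

Section FactorSystemOfExtension.
Variables (F : fieldType) (E : extension F).
Notation H := (ext_sub E).
Notation P := (ext_mid E).
Notation K := (ext_quo E).
Notation i := (ext_inj E).
Notation b := (ext_proj E).
Variables (s : {linear K -> P}) (sK : cancel s b).

Lemma proj_inj a : b (i a) = 0.
Proof. by apply/ext_exact; exists a. Qed.

(** The element [p - s (b p)] is in the kernel of [b], hence comes from a unique
element of H, which is the H-coordinate of [p] in the splitting by [s]. *)
Lemma retraction_exists : exists r : {linear P -> H},
  forall p, p = i (r p) + s (b p).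
Proof.
have /choice[r rP] p : exists a, p - s (b p) = i a.
  by apply/ext_exact; rewrite linearB /= sK subrr.
have r_lin : linear r.
  move=> c p q; apply: (@ext_inj_injective _ E).
  by rewrite linearP /= -!rP !linearP /= scalerDr; abel.
by exists (linear_of r_lin) => p; rewrite /= -rP subrK.
Qed.

Variables (r : {linear P -> H}) (rP : forall p, p = i (r p) + s (b p)).

Lemma inj_retr p : i (r p) = p - s (b p).
Proof. by rewrite {2}(rP p) addrK. Qed.

Lemma inj_retr_ker p : b p = 0 -> i (r p) = p.
Proof. by rewrite inj_retr => ->; rewrite linear0 subr0. Qed.

Definition efs_f : {bilinear K -> K -> H} := bilinear_comp (pmul P) r s s.
Definition efs_h : {bilinear K -> K -> H} := bilinear_comp (pbr P) r s s.
Definition efs_gam2 : {bilinear K -> H -> H} := bilinear_comp (pmul P) r s i.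
Definition efs_Gam2 : {bilinear K -> H -> H} := bilinear_comp (pbr P) r s i.
Definition efs_gam (x : K) : {linear H -> H} := efs_gam2 x.
Definition efs_GamL (x : K) : {linear H -> H} := efs_Gam2 x.

Lemma efs_gam_linear a : linear (efs_gam^~ a).
Proof. exact: (linearPl efs_gam2 a). Qed.

Lemma efs_Gam_linear a : linear (efs_GamL^~ a).
Proof. exact: (linearPl efs_Gam2 a). Qed.

Lemma inj_f x y : i (efs_f x y) = s x ** s y - s (x ** y).
Proof. by rewrite inj_retr phomM !sK. Qed.
Lemma inj_h x y : i (efs_h x y) = {[s x, s y]} - s {[x, y]}.
Proof. by rewrite inj_retr phomB !sK. Qed.
Lemma inj_gam x a : i (efs_gam x a) = s x ** i a.
Proof. by rewrite inj_retr_ker // phomM proj_inj linear0r. Qed.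
Lemma inj_Gam x a : i (efs_GamL x a) = {[s x, i a]}.
Proof. by rewrite inj_retr_ker // phomB proj_inj linear0r. Qed.

(** The axioms are equations in H. As [i] is injective they can be checked in P,
where these rules turn each of them into a consequence of the axioms of P. *)
Definition injE :=
  (inj_f, inj_h, inj_gam, inj_Gam, phomM i, phomB i, linearN i, linearD i).

Lemma efs_GamM x a c :
  efs_GamL x (a ** c) = efs_GamL x a ** c + a ** efs_GamL x c.
Proof. by apply: ext_inj_injective; rewrite !injE pbr_leibnizr. Qed.

Lemma efs_GamB x a c :
  efs_GamL x {[a, c]} = {[efs_GamL x a, c]} + {[a, efs_GamL x c]}.
Proof.
by apply: ext_inj_injective; rewrite !injE pbr_brl subrK.
Qed.

Definition efs_Gam x : pder H := PDer (efs_GamM x) (efs_GamB x).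

Lemma efs_f_sym x y : efs_f x y = efs_f y x.
Proof. by rewrite /= pmulC. Qed.

Lemma efs_h_alt x : efs_h x x = 0.
Proof. by rewrite /= pbrxx linear0. Qed.

Lemma efs_gam_gamC x y a : efs_gam x (efs_gam y a) = efs_gam y (efs_gam x a).
Proof. by apply: ext_inj_injective; rewrite !injE pmulCA. Qed.

Lemma efs_gam_mul1 x y a :
  efs_gam (x ** y) a = efs_gam x (efs_gam y a) - a ** efs_f x y.
Proof.
apply: ext_inj_injective; rewrite !injE linearBr /= pmulA.
by rewrite ![i a ** _]pmulC; abel.
Qed.

Lemma efs_gam_mul x y a :
  efs_gam (x ** y) a = efs_gam y (efs_gam x a) - a ** efs_f x y /\
  efs_gam (x ** y) a = efs_gam x (efs_gam y a) - a ** efs_f x y.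
Proof. by rewrite [in X in X /\ _]efs_gam_gamC efs_gam_mul1. Qed.

Lemma efs_gam_br x y a :
  efs_gam {[x, y]} a =
  efs_GamL y (efs_gam x (- a)) + efs_gam x (efs_GamL y a) - a ** efs_h x y.
Proof.
apply: ext_inj_injective; rewrite !injE pbr_leibnizr linearBr linearNr /=.
by rewrite ![i a ** _]pmulC [{[s y, s x]}]pbrC !linearNr linearNl; abel.
Qed.

Lemma efs_gamM x a c :
  efs_gam x (a ** c) = a ** efs_gam x c /\
  efs_gam x (a ** c) = c ** efs_gam x a.
Proof.
split; apply: ext_inj_injective; rewrite !injE; first exact: pmulCA.
by rewrite [i a ** i c]pmulC pmulCA.
Qed.

Lemma efs_gamB x a c :
  efs_gam x {[a, c]} = {[efs_gam x a, c]} - a ** efs_GamL x c.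
Proof.
apply: ext_inj_injective; rewrite !injE pbr_leibniz.
by rewrite [i a ** _]pmulC; abel.
Qed.

Lemma efs_Gam_mul x y a :
  efs_GamL (x ** y) a =
  efs_gam y (efs_GamL x a) + efs_gam x (efs_GamL y a) + {[a, efs_f x y]}.
Proof.
apply: ext_inj_injective; rewrite !injE linearBr /= ![{[i a, _]}]pbrC.
by rewrite pbr_leibniz [{[_, _]} ** s y]pmulC; abel.
Qed.

Lemma efs_Gam_br x y a :
  efs_GamL {[x, y]} a =
  efs_GamL x (efs_GamL y a) - efs_GamL y (efs_GamL x a) - {[efs_h x y, a]}.
Proof.
by apply: ext_inj_injective; rewrite !injE linearBl /= pbr_brl; abel.
Qed.

Lemma efs_f_assoc x y z :
  efs_gam z (efs_f x y) + efs_f (x ** y) z =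
  efs_gam x (efs_f y z) + efs_f x (y ** z).
Proof.
apply: ext_inj_injective; rewrite !injE !linearBr /=.
by rewrite ![s z ** _]pmulC !pmulA; abel.
Qed.

Lemma efs_h_jacobi x y z :
  efs_h {[x, y]} z + efs_h {[y, z]} x + efs_h {[z, x]} y =
  efs_GamL z (efs_h x y) + efs_GamL x (efs_h y z) + efs_GamL y (efs_h z x).
Proof.
apply: ext_inj_injective; rewrite !injE !linearBr /=.
(* The values of [s] at double brackets cancel by the Jacobi identity of K, and
   the double brackets of values of [s] by that of P. *)
have := congr1 s (pbr_jacobi x y z).
rewrite !linearD linear0 /= [{[{[x, y]}, z]}]pbrC [{[{[y, z]}, x]}]pbrC.
rewrite [{[{[z, x]}, y]}]pbrC !linearN /= [{[s {[x, y]}, s z]}]pbrC.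
rewrite [{[s {[y, z]}, s x]}]pbrC [{[s {[z, x]}, s y]}]pbrC.
move=> /esym e; apply: (eq_from_sum e).
apply: (eq_from_sum (pbr_jacobi (s x) (s y) (s z))).
by abel.
Qed.

Lemma efs_h_leibniz x y z :
  efs_h (x ** y) z =
  efs_GamL z (efs_f x y) + efs_gam y (efs_h x z) + efs_f {[x, z]} y +
  efs_gam x (efs_h y z) + efs_f x {[y, z]}.
Proof.
apply: ext_inj_injective; rewrite !injE !linearBr /=.
rewrite pbr_leibniz linearD /= [{[s z, _ ** _]}]pbrC [{[s z, _]}]pbrC.
rewrite pbr_leibniz ![_ ** s y]pmulC.
by abel.
Qed.

Definition efs : factor_system F :=
  @FactorSystem F H K efs_f efs_h efs_gam efs_Gam efs_f_sym efs_h_alt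
    efs_gam_linear efs_Gam_linear efs_gam_mul efs_gam_br efs_gamM efs_gamB
    efs_Gam_mul efs_Gam_br efs_f_assoc efs_h_jacobi efs_h_leibniz.

(** * Every extension is a crossed product *)

Definition glue_fun (u : crossed_product efs) : P := i u.1 + s u.2.

Lemma glue_linear : linear glue_fun.
Proof. by move=> c u v; rewrite /glue_fun !linearP /= scalerDr addrACA. Qed.

Definition glueL := linear_of glue_linear.

Lemma glueM u v : glueL (u ** v) = glueL u ** glueL v.
Proof.
case: u v => [a x] [c y] /=; rewrite /glue_fun /= !linearDl !linearDr /= !injE.
by rewrite [i a ** s y]pmulC; abel.
Qed.

Lemma glueB u v : glueL {[u, v]} = {[glueL u, glueL v]}.
Proof.
case: u v => [a x] [c y] /=; rewrite /glue_fun /= !linearDl !linearDr /= !injE.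
by rewrite [{[i a, s y]}]pbrC; abel.
Qed.

Definition glue : phom (crossed_product efs) P := PHom glueM glueB.

Lemma ext_glue_inj a : glue (cp_inj efs a) = i a.
Proof. by rewrite /= /glue_fun /= linear0 addr0. Qed.

Lemma ext_glue_proj u : cp_proj efs u = b (glue u).
Proof. by rewrite linearD /= proj_inj sK add0r. Qed.

Definition ext_glue : ext_mor (crossed_extension efs) E :=
  @ExtMor F (crossed_extension efs) E (phom_id H) glue (phom_id K)
    ext_glue_inj ext_glue_proj.

Lemma glue_injective : injective glue.
Proof.
move=> u v e; have := congr1 b e; rewrite -!ext_glue_proj => exy.
apply: injective_projections; last exact: exy.
apply: ext_inj_injective.
by move: e; rewrite /= /glue_fun -[u.2]/(cp_proj efs u) exy => /addIr.
Qed.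

(** The inverse of [glue] is given by the coordinates p |-> (r p, b p). *)
Lemma ext_glue_iso : is_iso (ext_glue : hom (crossed_extension efs : EXT F) E).
Proof.
pose v p : crossed_product efs := (r p, b p).
have vK : cancel v glue by move=> p; rewrite {2}(rP p).
have [w wE] := phom_inverse glue_injective vK.
have w_inj a : w (i a) = cp_inj efs a.
  by apply: glue_injective; rewrite wE vK ext_glue_inj.
have w_proj p : b p = cp_proj efs (w p) by rewrite wE.
exists (@ExtMor F E (crossed_extension efs) (phom_id H) w (phom_id K)
  w_inj w_proj).
split; apply: ext_mor_ext => // p /=; rewrite wE; last exact: vK.
by apply: glue_injective; rewrite vK.
Qed.
End FactorSystemOfExtension.

Lemma crossed_essentially_surjective (F : fieldType) :
  essentially_surjective (crossed_functor F).
Proof.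
move=> E; have [s sK] := linear_section (@ext_proj_surjective F E).
have [r rP] := retraction_exists sK.
by exists (efs sK rP), (ext_glue sK rP); exact: ext_glue_iso.
Qed.

Theorem theorem3p5 (F : fieldType) : equivalent_categories (EXT F) (FAC F).
Proof.
apply: equivalence_of_ffes (@crossed_essentially_surjective F).
exact: crossed_full_faithful.
Qed.
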